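(* Let $\mathfrak A$ be an algebra of subsets of a set $\Omega$, let $\mathfrak S_{\mathfrak A}$ be the sigma algebra generated by $\mathfrak A$, let $D:\mathfrak A\times\mathfrak A\to\mathbb C$ be a (strongly positive) decoherence functional, and let $\mu_{\mathsf v}:\mathfrak A\to\mathcal H$ be the associated quantum vector pre-measure with values in the histories Hilbert space $\mathcal H$ of $(\mathfrak A,D)$. Then $D$ extends to $\mathfrak S_{\mathfrak A}$ if and only if $\mu_{\mathsf v}$ extends to $\mathfrak S_{\mathfrak A}$.
   Context: Decoherence functional on an algebra $\mathfrak A$ over $\Omega$: a map $D:\mathfrak A\times\mathfrak A\to\mathbb C$ which is (1) Hermitian: $D(\alpha,\beta)=D(\beta,\alpha)^*$; (2) finitely bi-additive: additive over finite disjoint unions in each argument; (3) normalised: $D(\Omega,\Omega)=1$; (4) strongly positive: for every finite collection $\alpha_1,\dots,\alpha_k\in\mathfrak A$ the matrix $(D(\alpha_i,\alpha_j))_{ij}$ is positive semi-definite. Histories Hilbert space: let $V$ be the space of functions $u:\mathfrak A\to\mathbb C$ with finite support, with the (possibly degenerate) inner product $\langle u,v\rangle_V=\sum_{\alpha,\beta\in\mathfrak A}u^*(\alpha)v(\beta)D(\alpha,\beta)$. $\mathcal H$ is the set of Cauchy sequences in $V$ modulo $\{u_i\}\sim\{v_i\}$ iff $\|u_i-v_i\|_V\to0$, with the induced vector space operations and inner product $\langle[\{u_i\}],[\{v_i\}]\rangle=\lim_i\langle u_i,v_i\rangle_V$. The quantum vector pre-measure is $\mu_{\mathsf v}(\alpha)=[\chi_\alpha]$,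 the class of the constant sequence of $\chi_\alpha\in V$, where $\chi_\alpha(\alpha)=1$ and $\chi_\alpha(\beta)=0$ for $\beta\ne\alpha$. Thus $\langle\mu_{\mathsf v}(\alpha),\mu_{\mathsf v}(\beta)\rangle=D(\alpha,\beta)$, and $\mu_{\mathsf v}$ is finitely additive. A vector measure on a sigma algebra $\mathfrak S$ with values in a Banach space $\mathcal B$ is a map $\overline\eta:\mathfrak S\to\mathcal B$ with $\overline\eta(\bigcup_n\alpha_n)=\sum_n\overline\eta(\alpha_n)$ (norm convergence) for every sequence of pairwise disjoint $\alpha_n\in\mathfrak S$. The pre-measure $\mu_{\mathsf v}$ extends to $\mathfrak S_{\mathfrak A}$ if there is a unique vector measure $\overline{\mu_{\mathsf v}}:\mathfrak S_{\mathfrak A}\to\mathcal H$ with $\overline{\mu_{\mathsf v}}|_{\mathfrak A}=\mu_{\mathsf v}$. The decoherence functional $D$ extends to $\mathfrak S_{\mathfrak A}$ if there is a unique map $\overline D:\mathfrak S_{\mathfrak A}\times\mathfrak S_{\mathfrak A}\to\mathbb C$ that is Hermitian, strongly positive, normalised, countably bi-additive (countably additive over disjoint unions in each argument separately), and restricts to $D$ on $\mathfrak A\times\mathfrak A$. *)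

(* Defs.v *)
From HB Require Import structures.
From mathcomp Require Import all_boot all_order all_algebra generic_quotient.
From mathcomp Require Import all_classical all_reals all_analysis.
From mathcomp Require Import complex ring.

Set Implicit Arguments.
Unset Strict Implicit.
Unset Printing Implicit Defensive.
Import Order.TTheory GRing.Theory Num.Theory.
Import numFieldNormedType.Exports.

Local Open Scope classical_set_scope.
Local Open Scope ring_scope.

(* Set systems [S : set (set Omega)] are used as types: an element of [S] is a
   set [\val a : set Omega] together with a proof that it belongs to [S]. *)

Definition algebra_of_sets (Omega : Type) (A : set (set Omega)) : Prop :=
  [/\ A set0, setC_closed A & setU_closed A].

Definition gen_incl (Omega : Type) (A : set (set Omega)) (a : A) : <<s A >> :=
  SigSub (mem_set (@sub_sigma_algebra Omega setT A _ (set_valP a))).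

(* The order on a [numClosedFieldType] makes [0 <= z] imply that [z] is real. *)
Definition psdmx (C : numClosedFieldType) (k : nat) (M : 'M[C]_k) : Prop :=
  forall v : 'cV[C]_k, 0 <= ((map_mx Num.conj v)^T *m M *m v) 0 0.

Section functionals.
Variables (R : realType) (Omega : Type) (S : set (set Omega)).
Implicit Type D : S -> S -> R[i].

Definition hermitian_functional D := forall a b, D a b = Num.conj (D b a).

Definition strongly_positive D := forall (k : nat) (a : 'I_k -> S),
  psdmx (\matrix_(i, j) D (a i) (a j)).

Definition normalised D := exists2 o : S, \val o = [set: Omega] & D o o = 1.

(* [a] ranges over the elements of [S] that are a disjoint union of elements of
   [S]; such an [a] exists for every finite (resp. countable) disjoint family
   when [S] is an algebra (resp. a sigma-algebra). *)
Definition finitely_biadditive D := forall (n : nat) (F : 'I_n -> S) (a : S),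
  trivIset setT (fun i => \val (F i)) -> \val a = \bigcup_i \val (F i) ->
  forall b, D a b = \sum_(i < n) D (F i) b /\ D b a = \sum_(i < n) D b (F i).

(* [R[i]^o] is [R[i]] as a normed space over itself. *)
Definition countably_biadditive D := forall (F : nat -> S) (a : S),
  trivIset setT (fun n => \val (F n)) -> \val a = \bigcup_n \val (F n) ->
  forall b,
    (series (fun n => D (F n) b : R[i]^o) @ \oo --> (D a b : R[i]^o)) /\
    (series (fun n => D b (F n) : R[i]^o) @ \oo --> (D b a : R[i]^o)).

End functionals.

Record decoherence_functional (R : realType) (Omega : Type)
    (S : set (set Omega)) := DecoherenceFunctional {
  decoherence :> S -> S -> R[i] ;
  decoherence_hermitian : hermitian_functional decoherence ;
  decoherence_biadditive : finitely_biadditive decoherence ;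
  decoherence_normalised : normalised decoherence ;
  decoherence_positive : strongly_positive decoherence }.

Definition decoherence_extends (R : realType) (Omega : Type)
    (A : set (set Omega)) (D : decoherence_functional R A) : Prop :=
  exists! Dbar : <<s A >> -> <<s A >> -> R[i],
    [/\ hermitian_functional Dbar, strongly_positive Dbar, normalised Dbar,
        countably_biadditive Dbar &
        forall a b : A, Dbar (gen_incl a) (gen_incl b) = D a b].

Section vector_measures.
Variables (K : numFieldType) (B : completeNormedModType K) (Omega : Type).

Definition vector_measure (S : set (set Omega)) (eta : S -> B) : Prop :=
  forall (F : nat -> S) (a : S),
    trivIset setT (fun n => \val (F n)) -> \val a = \bigcup_n \val (F n) ->
    series (eta \o F) @ \oo --> eta a.

Definition vector_measure_extends (A : set (set Omega)) (mu : A -> B) : Prop :=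
  exists! eta : <<s A >> -> B,
    vector_measure eta /\ forall a : A, eta (gen_incl a) = mu a.

End vector_measures.

Section semi_inner_product.
Variables (C : numClosedFieldType) (V : lmodType C) (f : V -> V -> C).
Hypothesis fD : forall u v w, f u (v + w) = f u v + f u w.
Hypothesis fZ : forall a u v, f u (a *: v) = a * f u v.
Hypothesis fC : forall u v, f u v = Num.conj (f v u).
Hypothesis f_ge0 : forall u, 0 <= f u u.
Local Notation sn u := (sqrtC (f u u)).

Let fDl u v w : f (v + w) u = f v u + f w u.
Proof. by rewrite fC fD rmorphD/= -!fC. Qed.

Let fZl a u v : f (a *: v) u = Num.conj a * f v u.
Proof. by rewrite fC fZ rmorphM/= -fC. Qed.

Let exp_form a b u v : f (a *: u + b *: v) (a *: u + b *: v) =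
  `|a| ^+ 2 * f u u + `|b| ^+ 2 * f v v + (Num.conj a * b * f u v)
   + Num.conj (Num.conj a * b * f u v).
Proof.
rewrite fD !fDl !fZ !fZl !rmorphM/= conjCK -fC !normCK.
by ring.
Qed.

Lemma semi_inner_CS2 u v : `|f u v| ^+ 2 <= f u u * f v v.
Proof.
have cu : Num.conj (f u u) = f u u by rewrite -fC.
have cv : Num.conj (f v v) = f v v by rewrite -fC.
have ru : `|f u u| = f u u by rewrite ger0_norm.
have rv : `|f v v| = f v v by rewrite ger0_norm.
have nE : `|f u v| ^+ 2 = f u v * Num.conj (f u v) by rewrite normCK.
have hv : 0 <= f v v * (f u u * f v v - `|f u v| ^+ 2).
  have := f_ge0 (f v v *: u + (- Num.conj (f u v)) *: v).
  rewrite exp_form normrN norm_conjC rv cv.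
  suff -> : f v v ^+ 2 * f u u + `|f u v| ^+ 2 * f v v +
    f v v * - Num.conj (f u v) * f u v +
    Num.conj (f v v * - Num.conj (f u v) * f u v) =
    f v v * (f u u * f v v - `|f u v| ^+ 2) by [].
  by rewrite !rmorphM rmorphN/= conjCK cv nE; ring.
have hu : 0 <= f u u * (f u u * f v v - `|f u v| ^+ 2).
  have := f_ge0 ((- f u v) *: u + f u u *: v).
  rewrite exp_form normrN ru rmorphN.
  suff -> : `|f u v| ^+ 2 * f u u + f u u ^+ 2 * f v v +
     - Num.conj (f u v) * f u u * f u v +
    Num.conj (- Num.conj (f u v) * f u u * f u v) =
    f u u * (f u u * f v v - `|f u v| ^+ 2) by [].
  by rewrite !rmorphM rmorphN/= conjCK cu nE; ring.
have [v0|v0] := eqVneq (f v v) 0; last first.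
  by move: hv; rewrite pmulr_rge0 ?subr_ge0// lt_def v0 f_ge0.
have [u0|u0] := eqVneq (f u u) 0; last first.
  by move: hu; rewrite pmulr_rge0 ?subr_ge0// lt_def u0 f_ge0.
have := f_ge0 (1 *: u + (- Num.conj (f u v)) *: v).
rewrite exp_form u0 v0 !mulr0 !add0r rmorph1 mul1r !rmorphM rmorphN/= conjCK.
rewrite mulNr [Num.conj _ * _]mulrC -nE mulNr -nE -mulr2n mulNrn oppr_ge0.
by rewrite pmulrn_lle0.
Qed.

Lemma semi_inner_CS u v : `|f u v| <= sn u * sn v.
Proof.
rewrite -(@ler_pXn2r _ 2)// ?nnegrE ?mulr_ge0 ?sqrtC_ge0//.
by rewrite exprMn !sqrtCK; exact: semi_inner_CS2.
Qed.

Lemma semi_inner_triangle u v : sn (u + v) <= sn u + sn v.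
Proof.
rewrite -(@ler_pXn2r _ 2)// ?nnegrE ?addr_ge0 ?sqrtC_ge0//.
rewrite sqrtCK sqrrD !sqrtCK fD !fDl.
have cr : f u v + f v u <= (sn u * sn v) *+ 2.
  have re : f u v + f v u \is Num.real.
    by apply/CrealP; rewrite rmorphD/= -!fC addrC.
  apply: le_trans (real_ler_norm re) _.
  apply: le_trans (ler_normD _ _) _; rewrite mulr2n lerD ?semi_inner_CS//.
  by rewrite mulrC semi_inner_CS.
rewrite [leLHS](_ : _ = f u u + (f u v + f v u) + f v v); last by ring.
by rewrite lerD2r lerD2l.
Qed.

Lemma semi_inner_normZ a u : sn (a *: u) = `|a| * sn u.
Proof.
apply/eqP; rewrite -(@eqrXn2 _ 2)// ?mulr_ge0 ?sqrtC_ge0//.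
by rewrite exprMn !sqrtCK fZ fZl normCK; apply/eqP; ring.
Qed.

End semi_inner_product.

Section finite_support.
Variables (R : realType) (Omega : Type) (S : set (set Omega)).
Local Notation C := R[i].

Definition finsupp : {pred S -> C} :=
  [pred u : S -> C | `[< finite_set [set a | u a != 0] >]].

Lemma finsuppE u : (u \in finsupp) = `[< finite_set [set a | u a != 0] >].
Proof. by rewrite inE. Qed.

Lemma finsupp_submod_closed : submod_closed finsupp.
Proof.
split=> [|c u v]; rewrite !finsuppE.
  by apply/asboolP; apply: (@sub_finite_set _ _ set0) => // a /=; rewrite eqxx.
move=> /asboolP fu /asboolP fv; apply/asboolP.
apply: (@sub_finite_set _ _ ([set a | u a != 0] `|` [set a | v a != 0]));
  last by rewrite finite_setU.
move=> a /=; apply: contraPP => /not_orP[/negP/negPn/eqP + /negP/negPn/eqP].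
by rewrite !fctE => -> ->; rewrite scaler0 addr0 eqxx.
Qed.

HB.instance Definition _ := GRing.isSubmodClosed.Build C (S -> C) finsupp
  finsupp_submod_closed.

Record fsfunction := FsFunction {
  fsfunction_fun :> S -> C ; _ : fsfunction_fun \in finsupp }.

HB.instance Definition _ := [isSub for fsfunction_fun].
HB.instance Definition _ := [Choice of fsfunction by <:].
HB.instance Definition _ := [SubChoice_isSubLmodule of fsfunction by <:].

Lemma chi_subproof (a : S) : (fun b : S => (b == a)%:R : C) \in finsupp.
Proof.
rewrite finsuppE; apply/asboolP; apply: (@sub_finite_set _ _ [set a]) => //.
by move=> b /=; case: (eqVneq b a) => // _; rewrite eqxx.
Qed.

Definition chi (a : S) : fsfunction := FsFunction (chi_subproof a).

End finite_support.

Section inner_product.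
Variables (R : realType) (Omega : Type) (S : set (set Omega)).
Variable D : decoherence_functional R S.
Local Notation C := R[i].
Local Notation V := (fsfunction R S).

(* Both sums have finite support since [u] and [v] do. *)
Definition ipV (u v : V) : C :=
  \sum_(a \in [set: S]) \sum_(b \in [set: S]) Num.conj (u a) * v b * D a b.

Definition normV (u : V) : C := sqrtC (ipV u u).

Lemma ipV_seq (s : seq S) (u v : V) : uniq s ->
  (forall a, u a != 0 -> a \in s) -> (forall a, v a != 0 -> a \in s) ->
  ipV u v = \sum_(a <- s) \sum_(b <- s) Num.conj (u a) * v b * D a b.
Proof.
move=> us su sv; rewrite /ipV (@fsbigE _ _ _ _ _ s)//; last first.
  move=> a _ /(contraNN (su a))/negPn/eqP ->.
  by rewrite conjC0 fsbig1// => b _; rewrite !mul0r.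
under eq_bigl do rewrite in_setT.
apply: eq_bigr => a _; rewrite (@fsbigE _ _ _ _ _ s)//; last first.
  by move=> b _ /(contraNN (sv b))/negPn/eqP ->; rewrite mulr0 mul0r.
by under eq_bigl do rewrite in_setT.
Qed.

Lemma fsfunction_finite (u : V) : finite_set [set a | u a != 0].
Proof. by case: u => u /=; rewrite finsuppE => /asboolP. Qed.

Lemma fs_seq (us : seq V) :
  exists2 s : seq S, uniq s & forall u, u \in us -> forall a, u a != 0 -> a \in s.
Proof.
elim: us => [|u us [s s_uniq su]]; first by exists [::].
have /finite_seqP[t tE] := fsfunction_finite u.
exists (undup (t ++ s)); first exact: undup_uniq.
move=> w; rewrite inE => /orP[/eqP -> a ua|wus a wa]; rewrite mem_undup mem_cat.
  by apply/orP; left; have : [set` t] a by rewrite -tE.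
by rewrite (su w)// orbT.
Qed.

Lemma ipVD u v w : ipV u (v + w) = ipV u v + ipV u w.
Proof.
have [s us su] := fs_seq [:: u; v; w; v + w].
rewrite !(@ipV_seq s)//; try by apply: su; rewrite !inE eqxx ?orbT.
rewrite -big_split; apply: eq_bigr => a _; rewrite -big_split.
by apply: eq_bigr => b _ /=; rewrite mulrDr mulrDl.
Qed.

Lemma ipVZ c u v : ipV u (c *: v) = c * ipV u v.
Proof.
have [s us su] := fs_seq [:: u; v; c *: v].
rewrite !(@ipV_seq s)//; try by apply: su; rewrite !inE eqxx ?orbT.
rewrite mulr_sumr; apply: eq_bigr => a _; rewrite mulr_sumr.
apply: eq_bigr => b _; have -> : (c *: v) b = c * v b by [].
by ring.
Qed.

Lemma ipVC u v : ipV u v = Num.conj (ipV v u).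
Proof.
have [s us su] := fs_seq [:: u; v].
rewrite !(@ipV_seq s)//; try by apply: su; rewrite !inE eqxx ?orbT.
rewrite exchange_big rmorph_sum/=; apply: eq_bigr => a _.
rewrite rmorph_sum/=; apply: eq_bigr => b _.
by rewrite !rmorphM/= conjCK -decoherence_hermitian [v a * _]mulrC.
Qed.

Lemma ipV_ge0 u : 0 <= ipV u u.
Proof.
have [s us su] := fs_seq [:: u].
have {}su : forall a, u a != 0 -> a \in s by apply: su; rewrite mem_head.
rewrite (ipV_seq us su su).
have := @decoherence_positive _ _ _ D (size s) (tnth (in_tuple s))
  (\col_i u (tnth (in_tuple s) i)).
set M := (X in 0 <= X -> _); set N := (X in _ -> 0 <= X).
suff -> : M = N by [].
rewrite /M /N mxE exchange_big [RHS]big_tnth; apply: eq_bigr => j _.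
rewrite [RHS]big_tnth mxE mulr_suml; apply: eq_bigr => i _.
by rewrite !mxE mulrAC.
Qed.

Lemma ipV_chi a b : ipV (chi R a) (chi R b) = D a b.
Proof.
have [s [us sa sb]] : exists s : seq S, [/\ uniq s, a \in s & b \in s].
  exists (undup [:: a; b]).
  by rewrite undup_uniq !mem_undup !inE !eqxx orbT.
have sc (c d : S) : c \in s -> chi R c d != 0 -> d \in s.
  by move=> cs /=; case: (eqVneq d c) => [->//|_]; rewrite eqxx.
rewrite (ipV_seq us (sc a ^~ sa) (sc b ^~ sb)).
rewrite (bigD1_seq a)//= [X in _ + X]big1 => [|c /negPf ca]; last first.
  by rewrite big1// => d _; rewrite ca conjC0 !mul0r.
rewrite (bigD1_seq b)//= [X in _ + X + _]big1 => [|c /negPf cb]; last first.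
  by rewrite cb mulr0 mul0r.
by rewrite !eqxx conjC1 !mul1r !addr0.
Qed.

End inner_product.

Section complex_limits.
Variable R : realType.
Local Notation C := R[i].
Implicit Type z : nat -> C^o.

Lemma complex_cauchy_cvg z : (forall e : C, 0 < e -> exists N, forall m n,
    (N <= m)%N -> (N <= n)%N -> `|z m - z n| < e) -> cvg (z @ \oo).
Proof.
move=> zC.
have part (f : C -> R) : (forall x y, f (x - y) = f x - f y) ->
    (forall x, `|f x|%:C%C <= `|x|) -> cvg ((f \o z) n @[n --> \oo]).
  move=> fB fle; apply: R_complete; apply: cauchy_exP => e e0.
  have e0' : 0 < e%:C%C :> C by rewrite ltcR.
  have [N hN] := zC _ e0'; exists (f (z N)); exists N => // n /= Nn.
  rewrite /ball/= -ltcR; apply: le_lt_trans (hN N n _ _) => //.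
  by rewrite -fB.
have reB (x y : C) : complex.Re (x - y) = complex.Re x - complex.Re y.
  by rewrite raddfB.
have imB (x y : C) : complex.Im (x - y) = complex.Im x - complex.Im y.
  by rewrite raddfB.
have imle (x : C) : `|complex.Im x|%:C%C <= `|x|.
  rewrite -[`|x|]mulr1 -(@normCi C) -normrM.
  apply: le_trans (normc_ge_Re _).
  by case: x => a b /=; rewrite lecR !mulr0 !mulr1 sub0r normrN.
have /cvg_ex[a za] := part _ reB (@normc_ge_Re _).
have /cvg_ex[b zb] := part _ imB imle.
apply/cvg_ex; exists (a +i* b)%C; apply/cvgrPdist_lt => e e0.
have /complex_realP[r rE] := gtr0_real e0.
have r20 : 0 < r / 2 by rewrite divr_gt0// -ltcR -rE.
have {}za := (@cvgrPdist_lt _ R _ _ _ _ _).1 za _ r20.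
have {}zb := (@cvgrPdist_lt _ R _ _ _ _ _).1 zb _ r20.
near=> n.
have -> : (a +i* b)%C - z n =
    (a - complex.Re (z n))%:C%C + 'i%C * (b - complex.Im (z n))%:C%C.
  by rewrite [LHS]complexE reB imB.
apply: le_lt_trans (ler_normD _ _) _.
rewrite normrM normCi mul1r !normc_def/= !expr0n/= !addr0 !sqrtr_sqr.
rewrite -rmorphD/= rE ltcR [ltRHS](splitr r) ltrD//; near: n; [exact: za|exact: zb].
Unshelve. all: end_near. Qed.

Lemma complex_lim_ge0 z (l : C^o) : z @ \oo --> l ->
  (exists N, forall n, (N <= n)%N -> 0 <= z n) -> 0 <= l.
Proof.
move=> zl [M z0]; rewrite ger0_def eq_sym.
have zl' : z @ \oo --> (`|l| : C^o).
  apply: (@cvgrPdist_lt _ C^o _ _ _ _ _).2 => e e0.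
  have [N _ zN] := (@cvgrPdist_lt _ C^o _ _ _ _ _).1 zl _ e0.
  exists (maxn M N) => // n /=; rewrite geq_max => /andP[/z0 zn0 /zN].
  apply: le_lt_trans.
  by rewrite -{1}(ger0_norm zn0); exact: ler_dist_dist.
by apply/eqP; exact: (cvg_unique _ zl zl').
Qed.

Lemma complex_harmonic_lt (e : C) : 0 < e ->
  exists N, forall n, (N <= n)%N -> n.+1%:R^-1 < e.
Proof.
move=> e0; have /complex_realP[r rE] := gtr0_real e0.
have r0 : 0 < r by rewrite -ltcR -rE.
have [N _ hN] := near_infty_natSinv_lt (PosNum r0).
exists N => n /hN /=; rewrite rE -ltcR.
by rewrite rmorphV ?unitfE ?pnatr_eq0//= rmorph_nat.
Qed.

Lemma complex_cvg_conj z (l : C^o) : z @ \oo --> l ->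
  (fun n => Num.conj (z n) : C^o) @ \oo --> (Num.conj l : C^o).
Proof.
move=> zl; apply: (@cvgrPdist_lt _ C^o _ _ _ _ _).2 => e e0.
have [N _ zN] := (@cvgrPdist_lt _ C^o _ _ _ _ _).1 zl _ e0.
by exists N => // n /zN /=; rewrite -rmorphB norm_conjC.
Qed.

End complex_limits.

Section cauchy_sequences.
Variables (R : realType) (Omega : Type) (S : set (set Omega)).
Variable D : decoherence_functional R S.
Local Notation C := R[i].
Local Notation V := (fsfunction R S).
Local Notation ip := (ipV D).
Local Notation nV := (normV D).

Lemma normV_ge0 u : 0 <= nV u.
Proof. by rewrite sqrtC_ge0 ipV_ge0. Qed.

Lemma ler_normVD u v : nV (u + v) <= nV u + nV v.
Proof.
exact: (semi_inner_triangle (@ipVD _ _ _ D) (@ipVZ _ _ _ D) (@ipVC _ _ _ D)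
  (@ipV_ge0 _ _ _ D)).
Qed.

Lemma normVZ c u : nV (c *: u) = `|c| * nV u.
Proof.
exact: (semi_inner_normZ (@ipVZ _ _ _ D) (@ipVC _ _ _ D) (@ipV_ge0 _ _ _ D)).
Qed.

Lemma ipV_CS u v : `|ip u v| <= nV u * nV v.
Proof.
exact: (semi_inner_CS (@ipVD _ _ _ D) (@ipVZ _ _ _ D) (@ipVC _ _ _ D)
  (@ipV_ge0 _ _ _ D)).
Qed.

Lemma normV0 : nV 0 = 0.
Proof. by rewrite -(scale0r (0 : V)) normVZ normr0 mul0r. Qed.

Lemma normVN u : nV (- u) = nV u.
Proof. by rewrite -scaleN1r normVZ normrN normr1 mul1r. Qed.

Lemma ipV_Dl u v w : ip (v + w) u = ip v u + ip w u.
Proof. by rewrite ipVC ipVD rmorphD/= -!ipVC. Qed.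

Lemma ipV_Br u v w : ip u (v - w) = ip u v - ip u w.
Proof. by rewrite ipVD -scaleN1r ipVZ mulN1r. Qed.

Lemma ipV_Bl u v w : ip (v - w) u = ip v u - ip w u.
Proof. by rewrite ipVC ipV_Br rmorphB/= -!ipVC. Qed.

Definition is_cauchy (u : nat -> V) : Prop := forall e : C, 0 < e ->
  exists N, forall m n, (N <= m)%N -> (N <= n)%N -> nV (u m - u n) < e.

Definition cauchy_pred : {pred nat -> V} := [pred u | `[< is_cauchy u >]].

Lemma cauchy_predE u : (u \in cauchy_pred) = `[< is_cauchy u >].
Proof. by rewrite inE. Qed.

Lemma cauchy_submod_closed : submod_closed cauchy_pred.
Proof.
split=> [|c u v]; rewrite !cauchy_predE.
  by apply/asboolP => e e0; exists 0%N => m n _ _; rewrite subrr normV0.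
move=> /asboolP uC /asboolP vC; apply/asboolP => e e0.
have c1 : 0 < `|c| + 1 by rewrite ltr_wpDl.
have [|N hN] := uC (e / 2 / (`|c| + 1)); first by rewrite !divr_gt0.
have [|M hM] := vC (e / 2); first by rewrite divr_gt0.
exists (maxn N M) => m n; rewrite !geq_max => /andP[Nm Mm] /andP[Nn Mn].
have -> : (c *: u + v) m - (c *: u + v) n = c *: (u m - u n) + (v m - v n).
  by rewrite !fctE/= scalerBr opprD addrACA.
apply: le_lt_trans (ler_normVD _ _) _; rewrite [ltRHS]splitr.
rewrite ler_ltD ?hM// normVZ.
apply: (@le_trans _ _ ((`|c| + 1) * nV (u m - u n))).
  by rewrite ler_wpM2r ?normV_ge0// lerDl.
by rewrite mulrC -ler_pdivlMr// ltW// hN.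
Qed.

HB.instance Definition _ := GRing.isSubmodClosed.Build C (nat -> V) cauchy_pred
  cauchy_submod_closed.

Record cauchy_seq := CauchySeq {
  cauchy_seq_fun :> nat -> V ; _ : cauchy_seq_fun \in cauchy_pred }.

HB.instance Definition _ := [isSub for cauchy_seq_fun].
HB.instance Definition _ := [Choice of cauchy_seq by <:].
HB.instance Definition _ := [SubChoice_isSubLmodule of cauchy_seq by <:].

Lemma cauchy_seqP (u : cauchy_seq) : is_cauchy u.
Proof. by case: u => u /=; rewrite cauchy_predE => /asboolP. Qed.

Definition null_pred : {pred cauchy_seq} :=
  [pred u : cauchy_seq | `[< (fun n => nV (u n) : C^o) @ \oo --> (0 : C^o) >]].

Lemma null_predP (u : cauchy_seq) : reflect
  (forall e : C, 0 < e -> exists N, forall n, (N <= n)%N -> nV (u n) < e)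
  (u \in null_pred).
Proof.
rewrite inE; apply: (iffP idP) => [/asboolP u0 e e0|u0].
  have [N _ hN] := (@cvgrPdist_lt _ C^o _ _ _ _ _).1 u0 _ e0.
  exists N => n /hN /=.
  by rewrite sub0r normrN ger0_norm// normV_ge0.
apply/asboolP; apply: (@cvgrPdist_lt _ C^o _ _ _ _ _).2 => e /u0[N hN].
exists N => // n /hN /=.
by rewrite sub0r normrN ger0_norm// normV_ge0.
Qed.

Lemma null_submod_closed : submod_closed null_pred.
Proof.
split=> [|c u v].
  by apply/null_predP => e e0; exists 0%N => n _; rewrite normV0.
move=> /null_predP uC /null_predP vC; apply/null_predP => e e0.
have c1 : 0 < `|c| + 1 by rewrite ltr_wpDl.
have [|N hN] := uC (e / 2 / (`|c| + 1)); first by rewrite !divr_gt0.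
have [|M hM] := vC (e / 2); first by rewrite divr_gt0.
exists (maxn N M) => n; rewrite !geq_max => /andP[Nn Mn].
apply: le_lt_trans (ler_normVD _ _) _; rewrite [ltRHS]splitr.
rewrite ler_ltD ?hM// normVZ.
apply: (@le_trans _ _ ((`|c| + 1) * nV (u n))).
  by rewrite ler_wpM2r ?normV_ge0// lerDl.
by rewrite mulrC -ler_pdivlMr// ltW// hN.
Qed.

HB.instance Definition _ := GRing.isSubmodClosed.Build C cauchy_seq null_pred
  null_submod_closed.

Lemma cauchy_bounded (w : cauchy_seq) : exists2 M, 0 < M &
  exists N, forall n, (N <= n)%N -> nV (w n) <= M.
Proof.
have [N hN] := cauchy_seqP w ltr01.
exists (nV (w N) + 1); first by rewrite ltr_wpDl ?normV_ge0.
exists N => n Nn; rewrite -[w n](subrK (w N)).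
by apply: le_trans (ler_normVD _ _) _; rewrite addrC lerD2l ltW// hN.
Qed.

Lemma ipV_cauchy (u v : cauchy_seq) : cvg ((fun n => ip (u n) (v n) : C^o) @ \oo).
Proof.
have [A A0 [a hA]] := cauchy_bounded u; have [B B0 [b hB]] := cauchy_bounded v.
apply: complex_cauchy_cvg => e e0.
have [|N hN] := cauchy_seqP v (e := e / 2 / A); first by rewrite !divr_gt0.
have [|M hM] := cauchy_seqP u (e := e / 2 / B); first by rewrite !divr_gt0.
exists (maxn (maxn a b) (maxn N M)) => m n.
rewrite !geq_max => /andP[/andP[am bm] /andP[Nm Mm]].
move=> /andP[/andP[an bn] /andP[Nn Mn]].
have -> : ip (u m) (v m) - ip (u n) (v n) =
    ip (u m) (v m - v n) + ip (u m - u n) (v n).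
  by rewrite ipV_Br ipV_Bl addrA subrK.
apply: le_lt_trans (ler_normD _ _) _; rewrite [ltRHS]splitr.
apply: ltrD; apply: le_lt_trans (ipV_CS _ _) _.
  apply: (@le_lt_trans _ _ (A * nV (v m - v n))).
    by rewrite ler_wpM2r ?normV_ge0// hA.
  by rewrite mulrC -ltr_pdivlMr// hN.
apply: (@le_lt_trans _ _ (nV (u m - u n) * B)).
  by rewrite ler_wpM2l ?normV_ge0// hB.
by rewrite -ltr_pdivlMr// hM.
Qed.

End cauchy_sequences.
Arguments cauchy_pred {R Omega S} D.
Arguments null_pred {R Omega S} D.
Arguments ipV_cauchy {R Omega S D} u v.

(* The set [H] of Cauchy sequences in [V] modulo null sequences: two Cauchy
   sequences are identified when their difference is null. *)
Definition histories (R : realType) (Omega : Type) (S : set (set Omega))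
    (D : decoherence_functional R S) : Type := Quotient.quot (null_pred D).

HB.instance Definition _ (R : realType) (Omega : Type) (S : set (set Omega))
  (D : decoherence_functional R S) := Choice.on (histories D).
HB.instance Definition _ (R : realType) (Omega : Type) (S : set (set Omega))
  (D : decoherence_functional R S) := GRing.Zmodule.on (histories D).
HB.instance Definition _ (R : realType) (Omega : Type) (S : set (set Omega))
  (D : decoherence_functional R S) := EqQuotient.on (histories D).

Section histories_space.
Variables (R : realType) (Omega : Type) (S : set (set Omega)).
Variable D : decoherence_functional R S.
Local Notation C := R[i].
Local Notation V := (fsfunction R S).
Local Notation H := (histories D).
Local Notation ip := (ipV D).
Local Notation nV := (normV D).

Definition hclass (u : cauchy_seq D) : H := \pi_H%qT u.

Definition hscale (c : C) (x : H) : H := hclass (c *: repr x).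

Definition ipH (x y : H) : C :=
  lim ((fun n => ip (repr x n) (repr y n) : C^o) @ \oo).

Lemma hclass_eq u v : (hclass u = hclass v) <-> (u - v \in null_pred D).
Proof.
rewrite (Quotient.idealrBE (null_pred D)); split => [/eqP//|/eqP//].
Qed.

Lemma hclass_repr x : hclass (repr x) = x. Proof. exact: reprK. Qed.

Lemma hclassD u v : hclass (u + v) = hclass u + hclass v.
Proof. exact: (@Quotient.pi_add _ (null_pred D)). Qed.

Lemma hclassN u : hclass (- u) = - hclass u.
Proof. exact: (@Quotient.pi_opp _ (null_pred D)). Qed.

Lemma hclassZ_subproof c u : hclass (c *: u) = hscale c (hclass u).
Proof.
by apply/hclass_eq; rewrite -scalerBr rpredZ//; apply/hclass_eq;
  rewrite hclass_repr.
Qed.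

Lemma hscaleA a b x : hscale a (hscale b x) = hscale (a * b) x.
Proof. by rewrite -(hclass_repr x) -!hclassZ_subproof scalerA. Qed.

Lemma hscale1 : left_id 1 hscale.
Proof. by move=> x; rewrite -(hclass_repr x) -!hclassZ_subproof scale1r. Qed.

Lemma hscaleDr : right_distributive hscale +%R.
Proof.
move=> a x y; rewrite -(hclass_repr x) -(hclass_repr y).
by rewrite -hclassD -!hclassZ_subproof -hclassD scalerDr.
Qed.

Lemma hscaleDl x : {morph hscale^~ x : a b / a + b}.
Proof.
move=> a b; rewrite -(hclass_repr x).
by rewrite -!hclassZ_subproof -hclassD scalerDl.
Qed.

HB.instance Definition _ := GRing.Zmodule_isLmodule.Build C H
  hscaleA hscale1 hscaleDr hscaleDl.

Lemma hclassZ c u : hclass (c *: u) = c *: hclass u.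
Proof. exact: hclassZ_subproof. Qed.

Lemma hclassB u v : hclass (u - v) = hclass u - hclass v.
Proof. by rewrite hclassD hclassN. Qed.

(* [ipH] does not depend on the choice of representatives. *)
Lemma ipH_class (u v : cauchy_seq D) :
  (fun n => ip (u n) (v n) : C^o) @ \oo --> (ipH (hclass u) (hclass v) : C^o).
Proof.
have := ipV_cauchy (repr (hclass u)) (repr (hclass v)).
rewrite -/(ipH (hclass u) (hclass v)); set L := ipH _ _.
have /hclass_eq/null_predP := hclass_repr (hclass u).
have /hclass_eq/null_predP := hclass_repr (hclass v).
move: (repr (hclass u)) (repr (hclass v)) => u' v' vn un uvL.
apply: (@cvgrPdist_lt _ C^o _ _ _ _ _).2 => e e0.
have [A A0 [a hA]] := cauchy_bounded u'; have [B B0 [b hB]] := cauchy_bounded v.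
have [|M _ hM] := (@cvgrPdist_lt _ C^o _ _ _ _ _).1 uvL (e / 2).
  by rewrite divr_gt0.
have [|N hN] := vn (e / 2 / 2 / A); first by rewrite !divr_gt0.
have [|P hP] := un (e / 2 / 2 / B); first by rewrite !divr_gt0.
exists (maxn (maxn a b) (maxn M (maxn N P))) => // n /=.
rewrite !geq_max => /andP[/andP[an bn] /andP[Mn /andP[Nn Pn]]].
have -> : L - ip (u n) (v n) = (L - ip (u' n) (v' n)) +
    (ip (u' n) (v' n - v n) + ip (u' n - u n) (v n)).
  by rewrite ipV_Br ipV_Bl; ring.
apply: le_lt_trans (ler_normD _ _) _; rewrite [ltRHS]splitr.
apply: ltrD; first exact: hM.
apply: le_lt_trans (ler_normD _ _) _; rewrite [ltRHS]splitr.
apply: ltrD; apply: le_lt_trans (ipV_CS _ _ _) _.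
  apply: (@le_lt_trans _ _ (A * nV (v' n - v n))).
    by rewrite ler_wpM2r ?normV_ge0// hA.
  by rewrite mulrC -ltr_pdivlMr// hN.
apply: (@le_lt_trans _ _ (nV (u' n - u n) * B)).
  by rewrite ler_wpM2l ?normV_ge0// hB.
by rewrite -ltr_pdivlMr// hP.
Qed.

Arguments ipH_class u v : clear implicits.

Lemma ipH_unique (u v : cauchy_seq D) (l : C^o) :
  (fun n => ip (u n) (v n) : C^o) @ \oo --> l -> ipH (hclass u) (hclass v) = l.
Proof. by move=> uvl; exact: (cvg_unique _ (ipH_class u v) uvl). Qed.

Lemma ipHD x y z : ipH x (y + z) = ipH x y + ipH x z.
Proof.
rewrite -(hclass_repr x) -(hclass_repr y) -(hclass_repr z) -hclassD.
apply: ipH_unique; under eq_fun do rewrite ipVD.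
exact: (@cvgD _ C^o _ _ _ _ _ _ _ (ipH_class _ _) (ipH_class _ _)).
Qed.

Lemma ipHZ c x y : ipH x (c *: y) = c * ipH x y.
Proof.
rewrite -(hclass_repr x) -(hclass_repr y) -hclassZ.
apply: ipH_unique; under eq_fun do rewrite ipVZ.
exact: (@cvgZr _ C^o _ _ _ _ _ _ (ipH_class _ _)).
Qed.

Lemma ipHC x y : ipH x y = Num.conj (ipH y x).
Proof.
rewrite -(hclass_repr x) -(hclass_repr y).
apply: ipH_unique; under eq_fun do rewrite ipVC.
exact: complex_cvg_conj (ipH_class _ _).
Qed.

Lemma ipH_ge0 x : 0 <= ipH x x.
Proof.
rewrite -(hclass_repr x).
by apply: complex_lim_ge0 (ipH_class _ _) _; exists 0%N => n _; exact: ipV_ge0.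
Qed.

Definition normH (x : H) : C := sqrtC (ipH x x).

Lemma ler_normHD x y : normH (x + y) <= normH x + normH y.
Proof. exact: (semi_inner_triangle ipHD ipHZ ipHC ipH_ge0). Qed.

Lemma normHZ c x : normH (c *: x) = `|c| * normH x.
Proof. exact: (semi_inner_normZ ipHZ ipHC ipH_ge0). Qed.

Lemma normH_eq0 x : normH x = 0 -> x = 0.
Proof.
rewrite /normH => /eqP; rewrite sqrtC_eq0 -(hclass_repr x) => /eqP x0.
have -> : (0 : H) = hclass 0.
  by rewrite -(scale0r (0 : cauchy_seq D)) hclassZ scale0r.
apply/hclass_eq; rewrite subr0; apply/null_predP => e e0.
have := ipH_class (repr x) (repr x); rewrite x0 => xc.
have [|N _ hN] := (@cvgrPdist_lt _ C^o _ _ _ _ _).1 xc (e ^+ 2).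
  by rewrite exprn_gt0.
exists N => n /hN /=; rewrite sub0r normrN ger0_norm ?ipV_ge0// => lt.
by rewrite -(@ltr_pXn2r _ 2)// ?nnegrE ?normV_ge0 ?(ltW e0)// sqrtCK.
Qed.

HB.instance Definition _ := isPointed.Build H 0.
HB.instance Definition _ := @Lmodule_isNormed.Build C H normH
  ler_normHD normHZ normH_eq0.

Lemma histories_normE (x : H) : `|x| = sqrtC (ipH x x). Proof. by []. Qed.

End histories_space.
Arguments ipH_class {R Omega S D} u v.

Section histories_complete.
Variables (R : realType) (Omega : Type) (S : set (set Omega)).
Variable D : decoherence_functional R S.
Local Notation C := R[i].
Local Notation V := (fsfunction R S).
Local Notation H := (histories D).

Lemma const_cauchy_subproof (v : V) : (fun _ : nat => v) \in cauchy_pred D.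
Proof.
rewrite cauchy_predE; apply/asboolP => e e0.
by exists 0%N => m n _ _; rewrite subrr normV0.
Qed.

(* The class in [H] of the constant sequence of [v]. *)
Definition hconst (v : V) : H := hclass (CauchySeq (const_cauchy_subproof v)).

Lemma ipH_const u v : ipH (hconst u) (hconst v) = ipV D u v.
Proof.
apply: ipH_unique; exact: (@cvg_cst C^o _ _ _ eventually_filter).
Qed.

Lemma norm_hconst v : `|hconst v| = normV D v.
Proof. by rewrite histories_normE ipH_const. Qed.

Lemma hconstB u v : hconst (u - v) = hconst u - hconst v.
Proof. by rewrite /hconst -hclassB; congr hclass; exact: val_inj. Qed.

Lemma norm_hclass_le (u : cauchy_seq D) (e : C) : 0 <= e ->
  (exists N, forall n, (N <= n)%N -> normV D (u n) <= e) -> `|hclass u| <= e.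
Proof.
move=> e0 [N hN]; rewrite histories_normE.
rewrite -(@ler_pXn2r _ 2)// ?nnegrE ?sqrtC_ge0 ?ipH_ge0// sqrtCK -subr_ge0.
apply: (@complex_lim_ge0 _ (fun n => e ^+ 2 - ipV D (u n) (u n))); last first.
  exists N => n /hN; rewrite -(@ler_pXn2r _ 2) ?nnegrE ?normV_ge0//.
  by rewrite sqrtCK subr_ge0.
have ec : (fun _ : nat => e ^+ 2 : C^o) @ \oo --> (e ^+ 2 : C^o).
  exact: (@cvg_cst C^o _ _ _ eventually_filter).
exact: (@cvgB _ C^o _ _ _ _ _ _ _ ec (ipH_class u u)).
Qed.

Lemma histories_complete (F : set_system H) : ProperFilter F -> cauchy F -> cvg F.
Proof.
move=> FF /cauchyP cF.
have r0 n : 0 < n.+1%:R^-1 :> C by rewrite invr_gt0.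
have /choice[v hv] n : exists v : V, F (ball (hconst v) n.+1%:R^-1).
  have rn0 : 0 < n.+1%:R^-1 / 2 :> C by rewrite divr_gt0.
  have [x Fx] := cF _ rn0.
  have [N hN] := cauchy_seqP (repr x) rn0.
  exists (repr x N); apply: filterS Fx => y.
  rewrite -!ball_normE/= => xy; rewrite [ltRHS]splitr.
  rewrite -(subrK x (hconst _)) -addrA.
  apply: le_lt_trans (ler_normD _ _) _; apply: ler_ltD => //.
  rewrite -{2}(hclass_repr x) -hclassB.
  apply: norm_hclass_le; first exact: ltW.
  by exists N => n' Nn'; apply/ltW/hN.
have vC : is_cauchy D v.
  move=> e e0; have [|N hN] := @complex_harmonic_lt _ (e / 2).
    by rewrite divr_gt0.
  exists N => m n Nm Nn.
  have [y []] := filter_ex (filterI (hv m) (hv n)).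
  rewrite -!ball_normE/= => ym yn.
  rewrite -norm_hconst hconstB -(subrK y (hconst (v m))) -addrA [ltRHS]splitr.
  apply: le_lt_trans (ler_normD _ _) _; apply: ltrD.
    by apply: lt_trans ym (hN _ Nm).
  by rewrite distrC; apply: lt_trans yn (hN _ Nn).
have vP : v \in cauchy_pred D by rewrite cauchy_predE; apply/asboolP.
apply/cvg_ex; exists (hclass (CauchySeq vP)); apply/fcvgrPdist_lt => e e0.
have e20 : 0 < e / 2 by rewrite divr_gt0.
have [N hN] := complex_harmonic_lt e20; have [M hM] := vC _ e20.
near=> y.
set n := maxn N M; have Fy : ball (hconst (v n)) n.+1%:R^-1 y.
  by near: y; exact: hv.
rewrite -(subrK (hconst (v n)) (hclass _)) -addrA [ltRHS]splitr.
apply: le_lt_trans (ler_normD _ _) _; apply: ler_ltD.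
  rewrite -hclassB; apply: norm_hclass_le; first exact: ltW.
  by exists M => m Mm; apply/ltW/hM => //; exact: leq_maxr.
move: Fy; rewrite -ball_normE/= => /lt_trans; apply; apply: hN.
exact: leq_maxl.
Unshelve. all: end_near. Qed.

HB.instance Definition _ := Uniform_isComplete.Build H histories_complete.

Definition quantum_premeasure (a : S) : H := hconst (chi R a).

Lemma ipH_quantum_premeasure a b :
  ipH (quantum_premeasure a) (quantum_premeasure b) = D a b.
Proof. by rewrite ipH_const ipV_chi. Qed.

End histories_complete.
Arguments quantum_premeasure {R Omega S} D.

(* Main.v *)
Require Import Defs.
From mathcomp Require Import all_boot all_order all_algebra.
From mathcomp Require Import all_classical all_reals all_analysis.
From mathcomp Require Import complex ring.

Set Implicit Arguments.
Unset Strict Implicit.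
Unset Printing Implicit Defensive.
Import Order.TTheory GRing.Theory Num.Theory.
Import numFieldNormedType.Exports.
Local Open Scope classical_set_scope.
Local Open Scope ring_scope.

(** If a vector measure [eta] extends the pre-measure, [<eta a, eta b>] extends
    [D].  Conversely, let [Dbar] extend [D] and let [mu'] be the pre-measure of
    [Dbar].  The vector [mu' a - \sum_(i < n) mu' (F i)] is the value of [mu'] on
    the tail [T n] of [F], so [mu'] is countably additive as soon as
    [Dbar (T n) (T n)] tends to 0.  Otherwise one finds disjoint blocks [b k] of
    the [F i] with [Dbar (b k) (b k)] bounded below and [Dbar (b j) (b k)] summably
    small for [j <> k]; with [c] the union of the blocks, [Dbar c (b k)] then stays
    away from 0, against the additivity of [Dbar c].  The values of [mu'] on
    [<<s A>>] lie in the closed span of its values on [A] (a Dynkin argument), and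
    this closed span is isometric to that of [mu] in the space of [D].
    Both uniqueness claims are Dynkin arguments. *)

(** * Dynkin induction, limits of sequences and telescoping sums *)

(** Pi-lambda theorem as an induction principle on the subtype: the sets carried by an element
    satisfying [P] form a Dynkin system containing the pi-system [A]; [val_inj] then returns to the
    given element. *)
Lemma generated_dynkin_ind (Omega : Type) (A : set (set Omega))
    (P : <<s A >> -> Prop) :
  setI_closed A -> A setT ->
  (forall a : A, P (gen_incl a)) ->
  (forall a b : <<s A >>, \val b = ~` \val a -> P a -> P b) ->
  (forall (F : nat -> <<s A >>) (a : <<s A >>),
    trivIset setT (fun n => \val (F n)) -> \val a = \bigcup_n \val (F n) ->
    (forall n, P (F n)) -> P a) ->
  forall a, P a.
Proof.
move=> AI AT Pincl PC PU a.
pose G := [set X | exists2 s : <<s A >>, \val s = X & P s].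
have dG : dynkin G.
  split.
  - by exists (gen_incl (SigSub (mem_set AT))) => //; exact: Pincl.
  - move=> _ [s <- Ps].
    have sC : <<s A >> (~` \val s).
      by rewrite -setTD; apply: sigma_algebraCD; exact: set_valP.
    exists (SigSub (mem_set sC)) => //; exact: PC Ps.
  - move=> F tF GF.
    have /choice[s sP] n : exists s : <<s A >>, \val s = F n /\ P s.
      by have [s sE Ps] := GF n; exists s.
    have sE n : \val (s n) = F n by case: (sP n).
    have Ps n : P (s n) by case: (sP n).
    have FE : F = (fun n => \val (s n)) by apply/funext => n; rewrite sE.
    have sU : <<s A >> (\bigcup_n F n).
      apply: sigma_algebra_bigcup => n; rewrite -sE; exact: set_valP.
    exists (SigSub (mem_set sU)) => //; apply: (PU s) => //=; first by rewrite -FE.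
    by rewrite FE.
have : G (\val a).
  have : <<d A >> (\val a).
    by rewrite setI_closed_g_dynkin_g_sigma_algebra//; exact: set_valP.
  move=> /(_ G); apply; split => // X AX.
  by exists (gen_incl (SigSub (mem_set AX))) => //; exact: Pincl.
by case=> s /val_inj ->.
Qed.

Lemma cvg_natP (K : numFieldType) (B : normedModType K) (u : nat -> B) (l : B) :
  u @ \oo --> l <->
  forall e : K, 0 < e -> exists N, forall n, (N <= n)%N -> `|l - u n| < e.
Proof.
split=> [/cvgrPdist_lt ul e /ul[N _ hN]|ul]; first by exists N.
by apply/cvgrPdist_lt => e /ul[N hN]; exists N.
Qed.

Lemma eq0_norm_lt (K : numFieldType) (B : normedModType K) (x : B) :
  (forall e : K, 0 < e -> `|x| < e) -> x = 0.
Proof.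
move=> xe; apply/eqP; apply/negPn/negP => x0.
by have := xe `|x|; rewrite normr_gt0 x0 ltxx => /(_ isT).
Qed.

(** [T n] splits into [F n] and [T n.+1], so the sum telescopes. Only binary additivity is assumed,
    so that this also applies to a pre-measure not yet known to be countably additive. *)
Lemma additive_partial_sum (Omega : Type) (S : set (set Omega)) (B : zmodType)
    (eta : S -> B) (F T : nat -> S) :
  (forall a b c : S, \val b `&` \val c = set0 -> \val a = \val b `|` \val c ->
    eta a = eta b + eta c) ->
  trivIset setT (fun n => \val (F n)) ->
  (forall n, \val (T n) = \bigcup_(i in [set i | (n <= i)%N]) \val (F i)) ->
  forall n, eta (T n) = eta (T 0%N) - \sum_(0 <= i < n) eta (F i).
Proof.
move=> etaU tF TE; elim=> [|n IHn]; first by rewrite big_nil subr0.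
rewrite big_nat_recr//= opprD addrA -IHn (etaU (T n) (F n) (T n.+1)).
- by rewrite addrAC subrr add0r.
- rewrite TE setI_bigcupr; apply: bigcup0 => i /= ni.
  by move/trivIsetP : tF; apply => //; rewrite ltn_eqF.
rewrite !TE; apply/seteqP; split => [x [i/=]|x [Fx|[i/= ni Fx]]].
- rewrite leq_eqVlt => /predU1P[<- Fx|ni Fx]; first by left.
  by right; exists i.
- by exists n => /=.
- by exists i => //=; exact: ltnW.
Qed.

(** * Countably additive maps on a sigma algebra *)

Section countably_additive.
Variables (K : numFieldType) (B : normedModType K) (Omega : Type).
Variables (S : set (set Omega)) (sigmaS : sigma_algebra setT S).

(* The same condition as [vector_measure], without completeness of [B]. *)
Definition countably_additive (eta : S -> B) : Prop :=
  forall (F : nat -> S) (a : S),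
    trivIset setT (fun n => \val (F n)) -> \val a = \bigcup_n \val (F n) ->
    series (eta \o F) @ \oo --> eta a.

Lemma sigma_algebra_bigcup_ex (F : nat -> S) (I : set nat) :
  exists a : S, \val a = \bigcup_(n in I) \val (F n).
Proof.
case: sigmaS => S0 _ SU.
have SF : S (\bigcup_(n in I) \val (F n)).
  rewrite bigcup_mkcond; apply: SU => n; case: ifP => _ //; exact: set_valP.
by exists (SigSub (mem_set SF)).
Qed.

Lemma sigma_algebra_set0_ex : exists z : S, \val z = set0.
Proof. by case: sigmaS => S0 _ _; exists (SigSub (mem_set S0)). Qed.

Variables (eta : S -> B) (etaS : countably_additive eta).

(** The terms of the convergent series attached to the constant sequence [z] tend to 0, and they all
    equal [eta z]. *)
Lemma countably_additive0 (z : S) : \val z = set0 -> eta z = 0.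
Proof.
move=> z0; have /cvgP/cvg_series_cvg_0 : series (eta \o fun=> z) @ \oo --> eta z.
  apply: etaS; last by rewrite z0 bigcup0.
  by move=> i j _ _; rewrite z0 setI0 => -[].
move=> /cvg_natP zc; apply: eq0_norm_lt => e /zc[N /(_ _ (leqnn N))].
by rewrite sub0r normrN.
Qed.

Lemma countably_additive_sum (n : nat) (F : 'I_n -> S) (a : S) :
  trivIset setT (fun i => \val (F i)) -> \val a = \bigcup_i \val (F i) ->
  eta a = \sum_(i < n) eta (F i).
Proof.
move=> tF aE; have [z z0] := sigma_algebra_set0_ex.
(* The finite family is padded with the empty set. *)
pose G i := if insub i is Some j then F j else z.
have GF (i : 'I_n) : G i = F i by rewrite /G valK.
have Gz i : (n <= i)%N -> G i = z by rewrite leqNgt => ni; rewrite /G insubN.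
have /cvg_natP cG : series (eta \o G) @ \oo --> eta a.
  apply: etaS.
    move=> i j _ _; have [ni|/Gz ->] := ltnP i n; last by rewrite z0 set0I => -[].
    have [nj|/Gz ->] := ltnP j n; last by rewrite z0 setI0 => -[].
    by rewrite (GF (Ordinal ni)) (GF (Ordinal nj)) => /(tF _ _ I I)[].
  rewrite aE; apply/seteqP; split => [x [i _ Fx]|x [i _]].
    by exists i => //; rewrite GF.
  have [ni|/Gz ->] := ltnP i n; last by rewrite z0.
  by rewrite (GF (Ordinal ni)); exists (Ordinal ni).
apply/eqP; rewrite -subr_eq0; apply/eqP/eq0_norm_lt => e /cG[N hN].
(* At index [n + N] the sum splits into the [n] wanted terms and [N] terms that vanish. *)
have := hN _ (leq_addl n N); rewrite /series/= big_mkord big_split_ord/=.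
rewrite [X in _ - (_ + X)]big1 ?addr0 => [|i _]; last first.
  by rewrite Gz ?leq_addr// countably_additive0.
by under eq_bigr do rewrite GF.
Qed.

Lemma countably_additiveU (a b c : S) : \val b `&` \val c = set0 ->
  \val a = \val b `|` \val c -> eta a = eta b + eta c.
Proof.
move=> bc aE; pose F (i : 'I_2) := if i == ord0 then b else c.
rewrite (@countably_additive_sum _ F a).
- by rewrite !big_ord_recl big_ord0 addr0.
- apply/trivIsetP => i j _ _; rewrite /F.
  by case: i => -[|[|//]] ?; case: j => -[|[|//]] ?//=; rewrite setIC.
- rewrite aE; apply/seteqP; split => [x [bx|cx]|x [i _]].
  + by exists ord0.
  + by exists (lift ord0 ord0).
  + by rewrite /F; case: ifP => _; [left|right].
Qed.

Lemma countably_additive_setC (a b o : S) : \val o = setT -> \val b = ~` \val a ->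
  eta b = eta o - eta a.
Proof.
move=> oT bE; rewrite (@countably_additiveU o a b) ?bE ?setICr ?oT ?setUCr//.
by rewrite addrAC subrr add0r.
Qed.

(** [eta (T n)] is the remainder of the convergent series for [eta (T 0%N)]. *)
Lemma countably_additive_tail (F T : nat -> S) :
  trivIset setT (fun n => \val (F n)) ->
  (forall n, \val (T n) = \bigcup_(i in [set i | (n <= i)%N]) \val (F i)) ->
  eta (T n) @[n --> \oo] --> (0 : B).
Proof.
move=> tF TE; have /cvg_natP T0 : series (eta \o F) @ \oo --> eta (T 0%N).
  by apply: etaS => //; rewrite TE; congr bigcup; apply/seteqP; split.
apply/cvg_natP => e /T0[N hN]; exists N => n /hN; rewrite /series/=.
by rewrite (additive_partial_sum countably_additiveU tF TE n) sub0r normrN.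
Qed.

End countably_additive.

(** Equality passes to complements by subtraction from the common value at the whole space, and to
    disjoint unions by uniqueness of limits. *)
Lemma eq_countably_additive (K : numFieldType) (B : normedModType K) (Omega : Type)
    (A : set (set Omega)) (eta nu : <<s A >> -> B) :
  setI_closed A -> A setT -> countably_additive eta -> countably_additive nu ->
  (forall a : A, eta (gen_incl a) = nu (gen_incl a)) -> forall a, eta a = nu a.
Proof.
move=> AI AT etaS nuS en.
have sA : sigma_algebra setT <<s A >> by exact: smallest_sigma_algebra.
pose o : <<s A >> := gen_incl (SigSub (mem_set AT)).
apply: (@generated_dynkin_ind _ _ (fun a => eta a = nu a)) => // [a b bE ab|F a tF aE FE].
  rewrite (countably_additive_setC sA etaS (o := o) _ bE)//.
  by rewrite (countably_additive_setC sA nuS (o := o) _ bE)// ab en.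
have := etaS _ _ tF aE; have -> : eta \o F = nu \o F by exact/funext.
by move=> ec; exact: (cvg_unique (@norm_hausdorff _ _) ec (nuS _ _ tF aE)).
Qed.

(** * The gliding hump argument *)

Section gliding_hump.
Variable R : realType.
Local Notation C := R[i].

Lemma geometric_half_le2 (n : nat) : \sum_(j < n) (2^-1 : C) ^+ j <= 2.
Proof.
suff -> : \sum_(j < n) (2^-1 : C) ^+ j = 2 - 2 * 2^-1 ^+ n.
  by rewrite lerBlDr lerDl mulr_ge0// exprn_ge0.
elim: n => [|n IHn]; first by rewrite big_ord0 expr0 mulr1 subrr.
by rewrite big_ord_recr/= IHn exprS; field.
Qed.

Lemma half_pow_le (m n : nat) : (m <= n)%N -> (2^-1 : C) ^+ n <= 2^-1 ^+ m.
Proof.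
move=> mn; apply: ler_wiXn2l => //.
by rewrite invf_le1// ler1n.
Qed.

(* From the remaining indices, each [N k.+1] is taken so large that all entries
   [g i (N k.+1)] with [i <= N k] are tiny. *)
Lemma almost_orthogonal_subsequence (g : nat -> nat -> C) (e d : C) :
  0 < d -> (forall i, g i n @[n --> \oo] --> (0 : C^o)) ->
  (forall N, exists2 n, (N <= n)%N & e <= g n n) ->
  exists N : nat -> nat, [/\ forall k, (N k < N k.+1)%N,
    forall k, e <= g (N k) (N k) &
    forall j k, (j < k)%N -> `|g (N j) (N k)| <= d * 2^-1 ^+ k].
Proof.
move=> d0 g0 ge.
have /choice[h hP] n : exists m, [/\ (n < m)%N, e <= g m m &
    forall i, (i <= n)%N -> `|g i m| <= d * 2^-1 ^+ n.+1].
  have dn0 : 0 < d * 2^-1 ^+ n.+1 by rewrite mulr_gt0// exprn_gt0// invr_gt0.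
  have /choice[M hM] i : exists M, forall m, (M <= m)%N ->
      `|g i m| <= d * 2^-1 ^+ n.+1.
    have [M hM] := (@cvg_natP _ C^o _ _).1 (g0 i) _ dn0.
    by exists M => m /hM; rewrite sub0r normrN => /ltW.
  have [m Mm em] := ge (maxn n.+1 (\max_(i < n.+1) M i)).
  exists m; split => //; first by apply: leq_trans Mm; exact: leq_maxl.
  move=> i ni; apply: hM; apply: leq_trans Mm.
  by rewrite (leq_trans _ (leq_maxr _ _))// (leq_bigmax (Ordinal (ni : (i < n.+1)%N))).
(* Starting from [h 0] rather than 0 gives the first index the lower bound [e] as well. *)
pose N k := iter k.+1 h 0%N.
have NS k : N k.+1 = h (N k) by [].
have Nlt k : (N k < N k.+1)%N by rewrite NS; case: (hP (N k)).
have Nge k : (k <= N k)%N by elim: k => // k IHk; exact: leq_ltn_trans IHk (Nlt k).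
exists N; split => // [k|j [//|k]].
  by rewrite /N iterS; case: (hP (iter k h 0%N)).
(* The construction gives the exponent [(N k).+1] at index [N k.+1]; since [k <= N k], this is at
   least as good as [k.+1]. *)
rewrite ltnS => jk; have [_ _ /(_ (N j))] := hP (N k); rewrite -NS => le.
apply: le_trans (le _) _; last by rewrite ler_wpM2l ?(ltW d0)// half_pow_le// ltnS Nge.
by elim: k jk {le} => [|k IHk]; [rewrite leqn0 => /eqP ->|
  rewrite leq_eqVlt => /predU1P[-> //|/IHk/leq_trans->//]; exact/ltnW].
Qed.

(* Here [g i j] stands for [D (T i) (T j)], where [T] decreases to the empty
   set, and [s n] for [D c (T n)], where [c] is the union of the blocks
   [T (p j) `\` T (q j)]. *)
Lemma gliding_hump (g : nat -> nat -> C) :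
  (forall i j, g i j = Num.conj (g j i)) -> (forall i, 0 <= g i i) ->
  (forall i, g i n @[n --> \oo] --> (0 : C^o)) ->
  (forall p q : nat -> nat, (forall k, p k < q k)%N ->
    (forall k, q k < p k.+1)%N ->
    exists2 s : nat -> C, s n @[n --> \oo] --> (0 : C^o) &
    forall k, series (fun j => g (p j) (p k) - g (q j) (p k) -
      (g (p j) (q k) - g (q j) (q k)) : C^o) @ \oo --> (s (p k) - s (q k) : C^o)) ->
  g n n @[n --> \oo] --> (0 : C^o).
Proof.
move=> gC g_ge0 g0 gs; apply: (@cvg_natP _ C^o _ _).2 => e e0; apply: contrapT => gge.
have {}gge N : exists2 n, (N <= n)%N & e <= g n n.
  apply: contrapT => noN; apply: gge; exists N => n Nn.
  rewrite sub0r normrN ger0_norm//.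
  (* The order on [C] is partial, so both sides are compared as reals. *)
  have [//|en] := real_ltP (ger0_real (g_ge0 n)) (gtr0_real e0).
  by exfalso; apply: noN; exists n.
(* Budget: the diagonal entry loses at most [d * 2], the other entries add up to at most
   [d * 4 * 2], and [e - d * 10] is [e / 2]. *)
pose d := e / 20.
have d0 : 0 < d by rewrite divr_gt0.
have [N [Nlt Ne Nd]] := almost_orthogonal_subsequence d0 g0 gge.
pose p k := N k.*2; pose q k := N k.*2.+1.
have [|| s s0 sS] := gs p q; rewrite /p /q //.
have off i j k : i != j -> (k <= maxn i j)%N -> `|g (N i) (N j)| <= d * 2^-1 ^+ k.
  move=> ij kij; have [{}ij|{}ij|/eqP] := ltngtP i j; last by rewrite (negPf ij).
    apply: le_trans (Nd _ _ ij) _; rewrite ler_wpM2l ?(ltW d0)// half_pow_le//.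
    by rewrite (maxn_idPr (ltnW ij)) in kij.
  rewrite gC norm_conjC; apply: le_trans (Nd _ _ ij) _.
  rewrite ler_wpM2l ?(ltW d0)// half_pow_le//.
  by rewrite (maxn_idPl (ltnW ij)) in kij.
(* By bi-additivity, this is the value of the functional at the blocks [j] and [k]. *)
pose b j k := g (p j) (p k) - g (q j) (p k) - (g (p j) (q k) - g (q j) (q k)).
have boff j k : j != k -> `|b j k| <= d * 4 * 2^-1 ^+ j.
  move=> jk; rewrite /b /p /q.
  have -> : d * 4 * 2^-1 ^+ j = (d * 2^-1 ^+ j + d * 2^-1 ^+ j) +
    (d * 2^-1 ^+ j + d * 2^-1 ^+ j) by ring.
  have jl : (j <= j.*2)%N by rewrite -addnn leq_addr.
  apply: le_trans (ler_normB _ _) _; apply: lerD;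
  apply: le_trans (ler_normB _ _) _; apply: lerD; apply: off.
  - by rewrite (inj_eq double_inj).
  - by rewrite (leq_trans jl)// leq_maxl.
  - by apply/eqP => /(congr1 odd); rewrite /= !odd_double.
  - by rewrite (leq_trans jl)// (leq_trans _ (leq_maxl _ _)).
  - by apply/eqP => /(congr1 odd); rewrite /= !odd_double.
  - by rewrite (leq_trans jl)// leq_maxl.
  - by rewrite eqSS (inj_eq double_inj).
  - by rewrite (leq_trans jl)// (leq_trans _ (leq_maxl _ _)).
have bdiag k : e - d * 2 <= `|b k k|.
  have -> : b k k = (g (p k) (p k) + g (q k) (q k)) -
      (g (q k) (p k) + g (p k) (q k)) by rewrite /b; ring.
  apply: le_trans (lerB_dist _ _); apply: lerB.
    rewrite ger0_norm ?addr_ge0//; apply: le_trans (Ne k.*2) _.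
    by rewrite lerDl.
  apply: le_trans (ler_normD _ _) _; rewrite mulr_natr mulr2n.
  by apply: lerD; (apply: le_trans (off _ _ 0%N _ _) _;
    [|exact: leq0n|by rewrite expr0 mulr1]);
    apply/eqP => /(congr1 odd); rewrite /= !odd_double.
(* Past [k], the diagonal term outweighs all the others together, whatever the length of the sum. *)
have partial k n : (k < n)%N -> e / 2 <= `|\sum_(j < n) b j k|.
  move=> kn; rewrite (bigD1 (Ordinal kn))//=.
  apply: le_trans (lerB_normD _ _).
  have -> : e / 2 = (e - d * 2) - d * 4 * 2 by rewrite /d; field.
  apply: lerB => //; apply: le_trans (ler_norm_sum _ _ _) _.
  apply: (@le_trans _ _ (\sum_(j < n | j != Ordinal kn) d * 4 * 2^-1 ^+ j)).
    by apply: ler_sum => j jk; apply: boff.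
  apply: (@le_trans _ _ (\sum_(j < n) d * 4 * 2^-1 ^+ j)).
    rewrite [leRHS](bigD1 (Ordinal kn))//= lerDr.
    by rewrite mulr_ge0 ?exprn_ge0 ?invr_ge0// mulr_ge0// ltW.
  by rewrite -mulr_sumr ler_wpM2l ?geometric_half_le2// mulr_ge0// ltW.
(* [e / 8] for each of [s (p k)] and [s (q k)] and [e / 4] for the partial sum make [e / 2], against
   [partial]. The same [k] is the threshold for [s] and the number of the block, since
   [k <= p k]. *)
have e80 : 0 < e / 8 by rewrite divr_gt0.
have [k sk] := (@cvg_natP _ C^o _ _).1 s0 _ e80.
have pk : (k <= p k)%N.
  have Nge m : (m <= N m)%N by elim: m => // m IHm; exact: leq_ltn_trans IHm (Nlt m).
  by apply: leq_trans (Nge _); rewrite -addnn leq_addr.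
have e40 : 0 < e / 4 by rewrite divr_gt0.
have [M hM] := (@cvg_natP _ C^o _ _).1 (sS k) _ e40.
(* Past [M] the series is close to its limit; past [k] the partial sum contains the diagonal
   term. *)
have := hM (maxn M k.+1) (leq_maxl _ _).
rewrite /series/= big_mkord => hb.
have := partial k (maxn M k.+1) (leq_maxr _ _).
set t := \sum_(j < _) _ in hb *; rewrite -/p -/q in hb.
suff tlt : `|t| < e / 2 by move=> /le_lt_trans/(_ tlt); rewrite ltxx.
have -> : t = (s (p k) - s (q k)) - (s (p k) - s (q k) - t) by ring.
apply: le_lt_trans (ler_normB _ _) _.
have -> : e / 2 = (e / 8 + e / 8) + e / 4 by field.
apply: ltrD => //; apply: le_lt_trans (ler_normB _ _) _.
have := sk (p k) pk; have := sk (q k) (leq_trans pk (ltnW (Nlt _))).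
by rewrite !sub0r !normrN => ? ?; exact: ltrD.
Qed.

End gliding_hump.


(** * Countably bi-additive functionals along decreasing tails *)

Section countably_biadditive.
Variables (R : realType) (Omega : Type) (S : set (set Omega)).
Hypothesis sigmaS : sigma_algebra setT S.
Variable D : S -> S -> R[i].
Hypothesis DC : hermitian_functional D.
Hypothesis Dpos : strongly_positive D.
Hypothesis Dadd : countably_biadditive D.
Local Notation C := R[i].

Lemma countably_biadditive_l (b : S) : countably_additive (fun a : S => D a b : C^o).
Proof.
move=> F a tF aE; have [Fl _] := Dadd tF aE b.
apply/cvg_natP => e e0.
have [N _ hN] := (@cvgrPdist_lt _ C^o _ _ _ _ _).1 Fl e e0.
by exists N => n Nn; have {hN} := hN n Nn; rewrite /series/=; exact: id.
Qed.

Lemma countably_biadditive_r (b : S) : countably_additive (fun a : S => D b a : C^o).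
Proof.
move=> F a tF aE; have [_ Fr] := Dadd tF aE b.
apply/cvg_natP => e e0.
have [N _ hN] := (@cvgrPdist_lt _ C^o _ _ _ _ _).1 Fr e e0.
by exists N => n Nn; have {hN} := hN n Nn; rewrite /series/=; exact: id.
Qed.

(** Allows an extension to be packed as a decoherence functional with a histories space of its
    own. *)
Lemma countably_biadditive_finitely : finitely_biadditive D.
Proof.
move=> n F a tF aE b; split.
  exact: (countably_additive_sum sigmaS (@countably_biadditive_l b)).
exact: (countably_additive_sum sigmaS (@countably_biadditive_r b)).
Qed.

Lemma strongly_positive_diag (a : S) : 0 <= D a a.
Proof.
have := Dpos (fun _ : 'I_1 => a) (const_mx 1).
rewrite mxE big_ord_recl big_ord0 addr0 mxE big_ord_recl big_ord0 addr0 !mxE.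
by rewrite conjC1 mul1r mulr1.
Qed.

(** Additivity in each argument separately only sends [D (T i) (T n)] to 0 for fixed [i];
    [gliding_hump] turns this into convergence along the diagonal. *)
Lemma countably_biadditive_tail (F T : nat -> S) :
  trivIset setT (fun n => \val (F n)) ->
  (forall n, \val (T n) = \bigcup_(i in [set i | (n <= i)%N]) \val (F i)) ->
  D (T n) (T n) @[n --> \oo] --> (0 : C^o).
Proof.
move=> tF TE; apply: (gliding_hump (g := fun i j => D (T i) (T j))).
- by move=> i j; exact: DC.
- by move=> i; exact: strongly_positive_diag.
- by move=> i; exact: (countably_additive_tail sigmaS (@countably_biadditive_r (T i)) tF TE).
move=> p q pq qp.
have qpW j k : (j < k)%N -> (q j <= p k)%N.
  elim: k => // k IHk; rewrite ltnS leq_eqVlt => /predU1P[->|/IHk].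
    exact: ltnW.
  by move=> /leq_trans; apply; apply: ltnW; exact: ltn_trans (qp k).
have /choice[b bE] j : exists b : S,
    \val b = \bigcup_(i in [set i | (p j <= i < q j)%N]) \val (F i).
  exact: sigma_algebra_bigcup_ex.
have [c cE] := sigma_algebra_bigcup_ex sigmaS b setT.
have tb : trivIset setT (fun j => \val (b j)).
  apply/trivIsetP => i j _ _ ij; apply: contrapT => /eqP/set0P[x []].
  rewrite !bE => -[m /= mi Fm] [n /= nj Fn].
  have mn : m = n by apply: tF => //; exists x.
  move: mi nj; rewrite {}mn => /andP[pn nq] /andP[pn' nq'].
  have [{}ij|{}ij|/eqP] := ltngtP i j; last by rewrite (negPf ij).
    by have := leq_trans nq (leq_trans (qpW _ _ ij) pn'); rewrite ltnn.
  by have := leq_trans nq' (leq_trans (qpW _ _ ij) pn); rewrite ltnn.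
have DbE j x : D (b j) x = D (T (p j)) x - D (T (q j)) x.
  rewrite (countably_additiveU sigmaS (@countably_biadditive_l x)
    (a := T (p j)) (b := b j) (c := T (q j))).
  - by rewrite addrK.
  - rewrite bE TE; apply/eqP/negPn/negP => /set0P[x' []].
    move=> [m /= mi Fm] [n /= nj Fn].
    have mn : m = n by apply: tF => //; exists x'.
    by move: mi; rewrite mn => /andP[_]; rewrite ltnNge nj.
  rewrite !TE bE; apply/seteqP; split => [y [i /= pi Fi]|y [[i/=]|[i/= qi]]].
  - by have [iq|qi] := ltnP i (q j); [left|right]; exists i => //=; apply/andP.
  - by move=> /andP[pi _] Fi; exists i.
  - by move=> Fi; exists i => //=; exact: leq_trans (ltnW (pq j)) qi.
exists (fun n => D c (T n)) => [|k].
  exact: (countably_additive_tail sigmaS (@countably_biadditive_r c) tF TE).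
(* Additivity in the first argument along [c] is used at [T (p k)] and at [T (q k)], and the two
   series are subtracted. *)
have cl x := @countably_biadditive_l x _ _ tb cE.
have h := @cvgB _ C^o _ _ _ _ _ _ _ (cl (T (p k))) (cl (T (q k))).
apply: (@cvg_natP _ C^o _ _).2 => e e0.
have [N hN] := (@cvg_natP _ C^o _ _).1 (h eventually_filter) e e0.
exists N => n /hN; rewrite !fctE /series/= -sumrB.
by congr (`|_ - _| < _); apply: eq_bigr => j _; rewrite !DbE.
Qed.

End countably_biadditive.

(** * Sums and limits in the histories space *)

Section histories_sums.
Variables (R : realType) (Omega : Type) (S : set (set Omega)).
Variable D : decoherence_functional R S.
Local Notation C := R[i].
Local Notation H := (histories D).
Local Notation mu := (quantum_premeasure D).

Lemma ipHN (x y : H) : ipH x (- y) = - ipH x y.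
Proof. by rewrite -scaleN1r ipHZ mulN1r. Qed.

Lemma ipHB (x y z : H) : ipH x (y - z) = ipH x y - ipH x z.
Proof. by rewrite ipHD ipHN. Qed.

Lemma ipHBl (x y z : H) : ipH (x - y) z = ipH x z - ipH y z.
Proof. by rewrite ipHC ipHB rmorphB/= -!ipHC. Qed.

Lemma ipH0 (x : H) : ipH x 0 = 0.
Proof. by rewrite -(subrr x) ipHB subrr. Qed.

Lemma ipH_CS (x y : H) : `|ipH x y| <= `|x| * `|y|.
Proof. exact: (semi_inner_CS (@ipHD _ _ _ D) (@ipHZ _ _ _ D) (@ipHC _ _ _ D)
  (@ipH_ge0 _ _ _ D)). Qed.

Lemma ipH_sumr (I : Type) (r : seq I) (x : H) (b : I -> C) (y : I -> H) :
  ipH x (\sum_(j <- r) b j *: y j) = \sum_(j <- r) b j * ipH x (y j).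
Proof.
elim/big_ind2: _ => [|u u' v v' <- <-|j _]; [exact: ipH0|exact: ipHD|exact: ipHZ].
Qed.

Lemma ipH_suml (I : Type) (r : seq I) (a : I -> C) (x : I -> H) (y : H) :
  ipH (\sum_(i <- r) a i *: x i) y = \sum_(i <- r) Num.conj (a i) * ipH (x i) y.
Proof.
rewrite ipHC ipH_sumr rmorph_sum; apply: eq_bigr => i _.
by rewrite rmorphM/= -ipHC.
Qed.

Lemma ipH_cvgl (u : nat -> H) (x y : H) : u @ \oo --> x ->
  ipH (u n) y @[n --> \oo] --> (ipH x y : C^o).
Proof.
move=> /cvg_natP ux; apply: (@cvg_natP _ C^o _ _).2 => e e0.
have y0 : 0 < `|y| + 1 by rewrite ltr_wpDl.
have [|N hN] := ux (e / (`|y| + 1)); first by rewrite divr_gt0.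
exists N => n /hN xu; rewrite -ipHBl; apply: le_lt_trans (ipH_CS _ _) _.
apply: (@le_lt_trans _ _ (`|x - u n| * (`|y| + 1))).
  by rewrite ler_wpM2l// lerDl.
by rewrite -ltr_pdivlMr.
Qed.

Lemma ipH_cvgr (u : nat -> H) (x y : H) : u @ \oo --> x ->
  ipH y (u n) @[n --> \oo] --> (ipH y x : C^o).
Proof.
move=> ux; under eq_fun do rewrite ipHC; rewrite ipHC.
exact: complex_cvg_conj (ipH_cvgl ux).
Qed.

(** Bi-additivity makes the difference of the two sides orthogonal to every [mu d], hence to itself,
    and a vector of norm 0 vanishes in the quotient. *)
Lemma quantum_premeasureU (a b c : S) : \val b `&` \val c = set0 ->
  \val a = \val b `|` \val c -> mu a = mu b + mu c.
Proof.
move=> bc aE; apply/eqP; rewrite -subr_eq0; apply/eqP; apply: normH_eq0.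
set x := _ - _; have xmu d : ipH x (mu d) = 0.
  rewrite ipHC /x opprD addrA !ipHB !ipH_quantum_premeasure.
  pose F (i : 'I_2) := if i == ord0 then b else c.
  have [_ ->] : D a d = \sum_(i < 2) D (F i) d /\ D d a = \sum_(i < 2) D d (F i).
    apply: decoherence_biadditive.
      apply/trivIsetP => i j _ _; rewrite /F.
      by case: i => -[|[|//]] ?; case: j => -[|[|//]] ?//=; rewrite setIC.
    rewrite aE; apply/seteqP; split => [y [bx|cx]|y [i _]].
    - by exists ord0.
    - by exists (lift ord0 ord0).
    - by rewrite /F; case: ifP => _; [left|right].
  by rewrite !big_ord_recl big_ord0 addr0 /F/= -addrA -opprD subrr conjC0.
by rewrite /normH {2}/x opprD addrA !ipHB !xmu !subr0 sqrtC0.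
Qed.

(** The remainder of the series is [mu (T n)], whose squared norm [D (T n) (T n)] tends to 0 by
    [countably_biadditive_tail]. *)
Lemma quantum_premeasure_countably_additive :
  sigma_algebra setT S -> countably_biadditive D -> countably_additive mu.
Proof.
move=> sigmaS Dadd F a tF aE.
have /choice[T TE] n := sigma_algebra_bigcup_ex sigmaS F [set i | (n <= i)%N].
have Ta : T 0%N = a.
  by apply: val_inj; rewrite /= TE aE; apply: eq_bigcupl; split.
have T0 := countably_biadditive_tail sigmaS (@decoherence_hermitian _ _ _ D)
  (@decoherence_positive _ _ _ D) Dadd tF TE.
apply/cvg_natP => e e0.
have [|N hN] := (@cvg_natP _ C^o _ _).1 T0 (e ^+ 2); first by rewrite exprn_gt0.
exists N => n /hN; rewrite /series/= -Ta.
rewrite -(additive_partial_sum quantum_premeasureU tF TE n).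
rewrite sub0r normrN -(ipH_quantum_premeasure D) ger0_norm ?ipH_ge0// => lt.
rewrite -(@ltr_pXn2r _ 2)// ?nnegrE ?normr_ge0 ?(ltW e0)//.
by rewrite histories_normE sqrtCK.
Qed.

End histories_sums.

(** * The isometry between the two closed spans *)

(* [corr w x] says that [w] and [x] are simultaneously approximated by the same
   linear combination of the values of the two pre-measures: it is the graph of
   the isometry between the closed spans of these values. *)
Section isometric_correspondence.
Variables (R : realType) (Omega : Type) (S S' : set (set Omega)).
Variables (D : decoherence_functional R S) (D' : decoherence_functional R S').
Variable inc : S -> S'.
Hypothesis incD : forall a b : S, D' (inc a) (inc b) = D a b.
Local Notation C := R[i].
Local Notation mu := (quantum_premeasure D).
Local Notation mu' := (quantum_premeasure D').

(** Lists may repeat a set, so a difference of combinations is a mere concatenation, with no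
    collecting of terms. *)
Let lin (l : seq (C * S)) : histories D := \sum_(p <- l) p.1 *: mu p.2.
Let lin' (l : seq (C * S)) : histories D' := \sum_(p <- l) p.1 *: mu' (inc p.2).

Let norm_lin l : `|lin' l| = `|lin l|.
Proof.
rewrite !histories_normE !ipH_suml; congr sqrtC; apply: eq_bigr => p _.
rewrite !ipH_sumr; congr (_ * _); apply: eq_bigr => q _.
by rewrite !ipH_quantum_premeasure incD.
Qed.

Let linB l m : exists n, lin n = lin l - lin m /\ lin' n = lin' l - lin' m.
Proof.
exists (l ++ [seq (- p.1, p.2) | p <- m]).
rewrite /lin /lin' !big_cat !big_map/= -!sumrN; split; congr (_ + _);
by apply: eq_bigr => p _; rewrite scaleNr.
Qed.

Definition corr (w : histories D') (x : histories D) : Prop :=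
  forall e : C, 0 < e ->
    exists l : seq (C * S), `|w - lin' l| < e /\ `|x - lin l| < e.

Lemma corr_inc (a : S) : corr (mu' (inc a)) (mu a).
Proof.
by move=> e e0; exists [:: (1, a)]; rewrite /lin /lin' !big_seq1/= !scale1r !subrr !normr0.
Qed.

Lemma corrB w x v y : corr w x -> corr v y -> corr (w - v) (x - y).
Proof.
move=> wx vy e e0; have e20 : 0 < e / 2 by rewrite divr_gt0.
have [l [wl xl]] := wx _ e20; have [m [vm ym]] := vy _ e20.
have [n [nE nE']] := linB l m; exists n; rewrite nE nE' (splitr e).
by split; rewrite opprD addrACA -opprD; apply: le_lt_trans (ler_normB _ _) _;
  exact: ltrD.
Qed.

Lemma corr0 : corr 0 0.
Proof.
by move=> e e0; exists [::]; rewrite /lin /lin' !big_nil !subrr !normr0.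
Qed.

Lemma corrD w x v y : corr w x -> corr v y -> corr (w + v) (x + y).
Proof.
move=> wx vy; rewrite -[v]opprK -[y]opprK; apply: corrB => //.
by rewrite -[- v]add0r -[- y]add0r; exact: corrB corr0 vy.
Qed.

(** The approximating combinations have equal norms in both spaces by [norm_lin], and the norm is
    continuous. *)
Lemma corr_norm w x : corr w x -> `|w| = `|x|.
Proof.
move=> wx; apply/eqP; rewrite -subr_eq0; apply/eqP.
apply: (@eq0_norm_lt _ C^o) => e e0.
have [|l [wl xl]] := wx (e / 2); first by rewrite divr_gt0.
have -> : `|w| - `|x| = (`|w| - `|lin' l|) - (`|x| - `|lin l|).
  by rewrite norm_lin; ring.
rewrite (splitr e); apply: le_lt_trans (ler_normB _ _) _.
by apply: ltrD; apply: le_lt_trans (ler_dist_dist _ _) _.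
Qed.

(** By [corr_norm], [x - y] has the norm of [w - w]. *)
Lemma corr_inj w x y : corr w x -> corr w y -> x = y.
Proof.
move=> wx wy; apply/eqP; rewrite -subr_eq0 -normr_eq0.
by rewrite -(corr_norm (corrB wx wy)) subrr normr0.
Qed.

Lemma corr_series (w : nat -> histories D') (x : nat -> histories D) n :
  (forall i, corr (w i) (x i)) -> corr (series w n) (series x n).
Proof.
move=> wx; elim: n => [|n IHn]; first by rewrite /series/= !big_nil; exact: corr0.
by rewrite /series/= !big_nat_recr//=; apply: corrD.
Qed.

(** The sequence [x] is Cauchy because the correspondence preserves distances; completeness of
    [histories D] supplies the limit. *)
Lemma corr_lim (w : nat -> histories D') (x : nat -> histories D) v :
  (forall n, corr (w n) (x n)) -> w @ \oo --> v -> exists y, corr v y.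
Proof.
move=> wx /cvg_natP wv.
have : cvg (x @ \oo).
  apply/cauchy_cvgP/cauchyP => e e0.
  have e20 : 0 < e / 2 by rewrite divr_gt0.
  have [N hN] := wv _ e20; exists (x N); exists N => // n /= Nn.
  rewrite -ball_normE/= -(corr_norm (corrB (wx N) (wx n))).
  rewrite -(subrK v (w N)) -addrA (splitr e).
  apply: le_lt_trans (ler_normD _ _) _; apply: ltrD; last exact: hN.
  by rewrite distrC; exact: hN.
move=> /cvg_ex[y /cvg_natP xy]; exists y => e e0.
have e20 : 0 < e / 2 by rewrite divr_gt0.
have [N hN] := wv _ e20; have [M hM] := xy _ e20.
have [l [wl xl]] := wx (maxn N M) _ e20; exists l.
have vn := hN _ (leq_maxl N M); have yn := hM _ (leq_maxr N M).
rewrite (splitr e); split.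
  rewrite -(subrK (w (maxn N M)) v) -addrA.
  by apply: le_lt_trans (ler_normD _ _) _; exact: ltrD.
rewrite -(subrK (x (maxn N M)) y) -addrA.
by apply: le_lt_trans (ler_normD _ _) _; exact: ltrD.
Qed.

End isometric_correspondence.

(** * From a functional to a vector measure and back *)

Section extension.
Variables (R : realType) (Omega : Type) (A : set (set Omega)).
Hypothesis algebraA : algebra_of_sets A.
Variable D : decoherence_functional R A.
Local Notation C := R[i].
Local Notation mu := (quantum_premeasure D).

Lemma algebra_setT : A setT.
Proof. by case: algebraA => A0 Acompl _; rewrite -setC0; exact: Acompl. Qed.

Lemma algebra_setI : setI_closed A.
Proof.
case: algebraA => _ Acompl AU X Y AX AY.
by rewrite -[X `&` Y]setCK setCI; apply: (Acompl); apply: AU; exact: Acompl.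
Qed.

Let sigmaA : sigma_algebra setT <<s A >> := @smallest_sigma_algebra _ _ _.

(** [eta] is the pre-measure [mu'] of [Dbar], transported into [histories D] by the
    correspondence. *)
Lemma decoherence_extends_vector_measure (Dbar : <<s A >> -> <<s A >> -> C) :
  hermitian_functional Dbar -> strongly_positive Dbar -> normalised Dbar ->
  countably_biadditive Dbar ->
  (forall a b : A, Dbar (gen_incl a) (gen_incl b) = D a b) ->
  exists2 eta : <<s A >> -> histories D,
    vector_measure eta & forall a : A, eta (gen_incl a) = mu a.
Proof.
move=> DC Dpos Dn Dadd DE.
pose D' := DecoherenceFunctional DC (countably_biadditive_finitely sigmaA Dadd)
  Dn Dpos.
have DE' a b : D' (gen_incl a) (gen_incl b) = D a b by exact: DE.
pose mu' := quantum_premeasure D'.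
have mu'S : countably_additive mu'.
  by apply: quantum_premeasure_countably_additive.
pose c := @corr _ _ _ _ D D' (@gen_incl _ A).
have /choice[eta etaP] : forall a, exists x, c (mu' a) x.
  pose o : <<s A >> := gen_incl (SigSub (mem_set algebra_setT)).
  apply: (@generated_dynkin_ind _ _ (fun a => exists x, c (mu' a) x)
    algebra_setI algebra_setT) => [a|a b bE [x ax]|F a tF aE /choice[x Fx]].
  - by exists (mu a); exact: corr_inc.
  - rewrite (countably_additive_setC sigmaA mu'S (o := o) _ bE)//.
    by eexists; apply: corrB ax; exact: corr_inc.
  - apply: (corr_lim DE' (w := series (mu' \o F)) (x := series x)).
      by move=> n; apply: corr_series.
    exact: mu'S.
exists eta => [F a tF aE|a]; last first.
  by apply: (corr_inj DE' (etaP _)); exact: corr_inc.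
apply/cvg_natP => e e0; have /cvg_natP/(_ _ e0)[N hN] := mu'S _ _ tF aE.
(* Corresponding remainders have equal norms. *)
exists N => n /hN; suff -> : `|mu' a - series (mu' \o F) n| =
  `|eta a - series (eta \o F) n| by [].
apply: (corr_norm DE'); apply: corrB; first exact: etaP.
by apply: corr_series => i; exact: etaP.
Qed.

(** Continuity of the inner product in each argument carries the additivity of [eta] over to
    [Dbar]. *)
Lemma vector_measure_functional (eta : <<s A >> -> histories D) :
  vector_measure eta -> (forall a : A, eta (gen_incl a) = mu a) ->
  let Dbar a b := ipH (eta a) (eta b) in
  [/\ hermitian_functional Dbar, strongly_positive Dbar, normalised Dbar,
      countably_biadditive Dbar &
      forall a b : A, Dbar (gen_incl a) (gen_incl b) = D a b].
Proof.
move=> etaS etamu Dbar.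
have DE (a b : A) : Dbar (gen_incl a) (gen_incl b) = D a b.
  by rewrite /Dbar !etamu ipH_quantum_premeasure.
split => //.
- by move=> a b; exact: ipHC.
- move=> k a v.
  (* The quadratic form at [v] is the squared norm of this combination. *)
  have := ipH_ge0 (\sum_(i < k) v i 0 *: eta (a i)).
  rewrite ipH_suml; set x := (X in 0 <= X -> _); set y := (X in _ -> 0 <= X).
  suff -> : x = y by [].
  rewrite /x /y -mulmxA mxE; apply: eq_bigr => i _; rewrite !mxE ipH_sumr.
  by congr (_ * _); apply: eq_bigr => j _; rewrite !mxE mulrC.
- have [X XT XN] := decoherence_normalised D.
  by exists (gen_incl X); rewrite ?DE.
- move=> F a tF aE b; have etaF := etaS _ _ tF aE.
  (* The coefficient 1 puts the partial sums in the form required by [ipH_suml] and [ipH_sumr]. *)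
  have seriesE n : series (eta \o F) n = \sum_(0 <= i < n) 1 *: eta (F i).
    by rewrite /series/=; apply: eq_bigr => i _; rewrite scale1r.
  split; apply: (@cvgrPdist_lt _ C^o _ _ _ _ _).2 => e e0.
    have [N hN] := (@cvg_natP _ C^o _ _).1 (ipH_cvgl (y := eta b) etaF) _ e0.
    exists N => // n /hN; rewrite seriesE ipH_suml/= /series/=.
    by under eq_bigr do rewrite conjC1 mul1r.
  have [N hN] := (@cvg_natP _ C^o _ _).1 (ipH_cvgr (y := eta b) etaF) _ e0.
  exists N => // n /hN; rewrite seriesE ipH_sumr/= /series/=.
  by under eq_bigr do rewrite mul1r.
Qed.

End extension.

Theorem mainTheorem1 (R : realType) (Omega : Type) (A : set (set Omega))
    (algebraA : algebra_of_sets A) (D : decoherence_functional R A) :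
  decoherence_extends D <-> vector_measure_extends (quantum_premeasure D).
Proof.
have AI := algebra_setI algebraA; have AT := algebra_setT algebraA.
split=> [[Dbar [[DC Dpos Dn Dadd DE] _]]|[eta [[etaS etamu] _]]].
  have [eta etaS etamu] :=
    decoherence_extends_vector_measure algebraA DC Dpos Dn Dadd DE.
  exists eta; split=> // nu [nuS numu]; apply/funext.
  by apply: eq_countably_additive => // a; rewrite etamu numu.
exists (fun a b => ipH (eta a) (eta b)).
have [DC Dpos Dn Dadd DE] := vector_measure_functional etaS etamu.
split=> // Dbar [_ _ _ Dbaradd DbarE]; apply/funext => a; apply/funext => b.
(* Uniqueness goes one argument at a time: the first is held in [A] while the second ranges over
   [<<s A >>], and then the first is released. *)
have incl (a' : A) (b' : <<s A >>) :
    ipH (eta (gen_incl a')) (eta b') = Dbar (gen_incl a') b'.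
  apply: (@eq_countably_additive _ R[i]^o _ A
    (fun b' => ipH (eta (gen_incl a')) (eta b')) (Dbar (gen_incl a'))) => //.
  - exact: (countably_biadditive_r Dadd).
  - exact: (countably_biadditive_r Dbaradd).
  - by move=> c; rewrite DE DbarE.
apply: (@eq_countably_additive _ R[i]^o _ A (fun a' => ipH (eta a') (eta b))
  (Dbar^~ b)) => //.
- exact: (countably_biadditive_l Dadd).
- exact: (countably_biadditive_l Dbaradd).
Qed.
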